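(* (1) Let $p_1,\dots,p_6$ be distinct primes with $p_i\le 19$ for $i=1,\dots,6$. Then every solution in non-negative integers $\alpha_1,\dots,\alpha_6$ of $$p_1^{\alpha_1}p_2^{\alpha_2}+p_3^{\alpha_3}p_4^{\alpha_4}-p_5^{\alpha_5}p_6^{\alpha_6}=1$$ satisfies $\min_{1\le i\le 6}\alpha_i\le 5$. (2) The equation $$2^{\alpha_1}3^{\alpha_2}+5^{\alpha_3}7^{\alpha_4}-11^{\alpha_5}13^{\alpha_6}=1$$ has exactly two solutions in non-negative integers $\alpha_1,\dots,\alpha_6$, namely $(\alpha_1,\dots,\alpha_6)=(0,0,0,0,0,0)$ and $(0,2,1,0,0,1)$. *)

(* Defs.v *)
From mathcomp Require Import all_boot.
Set Implicit Arguments.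
Unset Strict Implicit.
Unset Printing Implicit Defensive.

(* Main.v *)
Require Import Defs.
From Stdlib Require Import NArith List Lia.
From mathcomp Require Import all_boot zify.

(* Parity excludes the prime 2 from (1) and forces a1 = 0 in (2). The rest is a local obstruction: the three terms
   x = p1^a1 p2^a2, y = p3^a3 p4^a4, z = p5^a5 p6^a6 have no common residues satisfying x + y = z + 1 modulo
   all of a short list of small prime powers q at once (a term with p_i dividing q is 0 mod q, its exponents
   being large). For one q the triples of residues surviving x + y = z + 1 are few; passing to the next q, the
   term x is known to lie in a coset of the subgroup <p1, p2>, so only the cosets of the part of <p1, p2> that
   is trivial modulo the earlier q have to be tried. With a well-chosen order of the moduli few triples
   survive at each stage, and none at the end; one list of moduli serves all choices of six odd primes up to 19.
   In (2) the same works separately for a2 >= 3, a2 = 1 and a2 = 2, the last case split further according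
   to the exponent of 5 to isolate the true solution 9 + 5 = 13 + 1. *)

(** * Residue vectors and relations between two generators *)

Definition mulm (q a b : N) : N := N.modulo (N.mul a b) q.

Fixpoint powm_pos (q a : N) (e : positive) : N :=
  match e with
  | xH => N.modulo a q
  | xO e' => let b := powm_pos q a e' in mulm q b b
  | xI e' => let b := powm_pos q a e' in mulm q a (mulm q b b)
  end.

Definition powm (q a e : N) : N :=
  match e with N0 => N.modulo 1 q | Npos e' => powm_pos q a e' end.

Fixpoint mulv (qs u v : list N) : list N :=
  match qs, u, v with
  | q :: qs', a :: u', b :: v' => mulm q a b :: mulv qs' u' v'
  | _, _, _ => nil
  end.

Fixpoint powv (qs u : list N) (e : N) : list N :=
  match qs, u with
  | q :: qs', a :: u' => powm q a e :: powv qs' u' e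
  | _, _ => nil
  end.

Fixpoint pows (qs v g : list N) (n : nat) : list (list N) :=
  match n with O => nil | S n' => v :: pows qs (mulv qs v g) g n' end.

Definition residues (qs : list N) (f : N -> N) : list N :=
  List.map (fun q => N.modulo (f q) q) qs.

Definition grid (qs b c : list N) (k o : nat) : list (list N) :=
  List.flat_map (fun u => pows qs u c o) (pows qs (residues qs (fun=> 1%num)) b k).

Fixpoint cycle_from (q c v : N) (fuel : nat) : list N :=
  match fuel with
  | O => nil
  | S f => v :: let w := mulm q v c in
                if N.eqb w 1 then nil else cycle_from q c w f
  end.

(** When [b^k] is met at position [i] of the cycle of [c], we have [b^k = c^i]; with [o = size cs]
    and [c^o = 1], the exponent [j = o - i] gives [b^k c^j = 1]. *)
Fixpoint relation_from (q b v : N) (cs : list N) (k fuel : nat) : nat * nat :=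
  match fuel with
  | O => (k, O)
  | S f => let i := find (N.eqb v) cs in
           if i < size cs then (k, size cs - i)
           else relation_from q b (mulm q v b) cs k.+1 f
  end.

(* Numbers [o], [k], [j] with c^o = 1 and b^k c^j = 1 modulo q. They are only searched for here: [is_relation]
   verifies them, and [levels] needs no minimality. *)
Definition relation (q b c : N) : nat * nat * nat :=
  let cs := cycle_from q c 1 400 in
  let kj := relation_from q b b cs 1 400 in
  (size cs, kj.1, kj.2).

Definition is_relation (q b c : N) (o k j : nat) : bool :=
  [&& 0 < o, 0 < k,
      N.eqb (powm q c (N.of_nat o)) (N.modulo 1 q) &
      N.eqb (mulm q (powm q b (N.of_nat k)) (powm q c (N.of_nat j))) (N.modulo 1 q)].

(* [b] and [c] hold the residues, modulo each q of [qs], of two generators of the group of the values that are 1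
   modulo the earlier moduli. The first q cuts it down to the subgroup generated by b^k c^j and c^o, with coset
   representatives b^s c^t, s < k and t < o. *)
Fixpoint levels (qs b c : list N) : list (list (list N)) :=
  match qs, b, c with
  | q :: qs', b0 :: b', c0 :: c' =>
    let: (o, k, j) := relation q b0 c0 in
    if is_relation q b0 c0 o k j
    then grid qs b c k o
         :: levels qs' (mulv qs' (powv qs' b' (N.of_nat k)) (powv qs' c' (N.of_nat j)))
                       (powv qs' c' (N.of_nat o))
    else nil
  | _, _, _ => nil
  end.

(** * Tries of residues and the search through them *)

(* A node lists the possible residues modulo the current q, each with the trie for the remaining moduli.
   [Bad] records that no trie could be computed; it covers everything and is never refuted. *)
Inductive trie := Bad | Node of list (N * trie).

Fixpoint build (qs : list N) (lv : list (list (list N))) (r : list N) : trie :=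
  match qs, lv with
  | nil, _ => Node nil
  | _ :: _, nil => Bad
  | q :: qs', gs :: lv' =>
    Node (List.map (fun w => (head 0%num w, build qs' lv' (behead w)))
                   (List.map (mulv qs r) gs))
  end.

(* The residue of x + y - 1 modulo q, for s the sum of the residues of x and y. *)
Definition target (q s : N) : N :=
  if N.eqb s 0 then N.pred q
  else if N.leb s q then N.pred s else N.sub (N.pred s) q.

Fixpoint refutes (qs : list N) (tx ty tz : trie) : bool :=
  match qs, tx, ty, tz with
  | q :: qs', Node lx, Node ly, Node lz =>
    List.forallb (fun ex => List.forallb (fun ey =>
      let s := target q (N.add ex.1 ey.1) in
      List.forallb (fun ez => if N.eqb ez.1 s then refutes qs' ex.2 ey.2 ez.2 else true) lz)
      ly) lx
  | _, _, _, _ => false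
  end.

(* 2^4 3^3 5 11, a multiple of the order of every unit p modulo q used below, so that p^period = 1 mod q
   recognises the units. *)
Definition period : N := 23760.

Definition is_unit (p q : N) : bool := N.eqb (powm q p period) (N.modulo 1 q).

(** Where [p] or [p'] is not recognised as a unit, [r] has to vanish modulo [q]; generators 1 and
    starting value 0 then encode the constant residue 0. *)
Definition tree (qs : list N) (r p p' : N) : trie :=
  let u q := is_unit p q && is_unit p' q in
  if List.forallb (fun q => u q || N.eqb (N.modulo r q) 0) qs then
    build qs (levels qs (residues qs (fun q => if u q then p else 1%num))
                        (residues qs (fun q => if u q then p' else 1%num)))
             (residues qs (fun q => if u q then r else 0%num))
  else Bad.

(** * The finite check for (1) *)

(** All these unit groups have orders built from 2, 3, 5 and 11 only, so the moduli share many group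
    factors and later levels branch little. *)
Definition sieve : list N :=
  [:: 3; 5; 8; 7; 13; 9; 19; 16; 37; 27; 73; 109; 17; 181; 11; 61; 41; 25; 241; 64; 81; 121; 67; 331; 199]%num.

Definition odd_primes : list N := [:: 3; 5; 7; 11; 13; 17; 19]%num.

Definition prime_pairs : list (N * N) :=
  List.filter (fun e => N.ltb e.1 e.2) (List.list_prod odd_primes odd_primes).

(** The sixth powers encode that all exponents exceed 5; they vanish modulo the powers of 3, 5, 7,
    ... in [sieve] that involve a prime of the pair. *)
Definition entry (e : N * N) : N * N * trie :=
  (e, tree sieve (N.mul (N.pow e.1 6) (N.pow e.2 6)) e.1 e.2).

Definition entries : list (N * N * trie) := List.map entry prime_pairs.

Definition disjoint_pairs (e f : N * N) : bool :=
  [&& ~~ N.eqb e.1 f.1, ~~ N.eqb e.1 f.2, ~~ N.eqb e.2 f.1 & ~~ N.eqb e.2 f.2].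

(** The equation is symmetric in its first two terms, so these are tried only in the order of their
    least primes. *)
Definition refutes_entries (es : list (N * N * trie)) : bool :=
  List.forallb (fun ex => List.forallb (fun ey =>
    if N.ltb ex.1.1 ey.1.1 && disjoint_pairs ex.1 ey.1 then
      List.forallb (fun ez =>
        if disjoint_pairs ex.1 ez.1 && disjoint_pairs ey.1 ez.1
        then refutes sieve ex.2 ey.2 ez.2 else true) es
    else true) es) es.

(** * Correctness of the residue arithmetic *)

Lemma powm_posE (q a : N) (e : positive) : powm_pos q a e = N.modulo (N.pow a (Npos e)) q.
Proof.
elim: e => [e IH|e IH|]; last (by rewrite N.pow_1_r); rewrite [LHS]/=.
- rewrite /mulm IH -N.Div0.mul_mod N.Div0.mul_mod_idemp_r -N.pow_add_r -N.pow_succ_r'.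
  by congr N.modulo; congr N.pow; lia.
- by rewrite /mulm IH -N.Div0.mul_mod -N.pow_add_r; congr N.modulo; congr N.pow; lia.
Qed.

Lemma powmE (q a e : N) : powm q a e = N.modulo (N.pow a e) q.
Proof. by case: e => [|e] //; exact: powm_posE. Qed.

Lemma mod_mul (q a a' b b' : N) :
  N.modulo a q = N.modulo a' q -> N.modulo b q = N.modulo b' q ->
  N.modulo (N.mul a b) q = N.modulo (N.mul a' b') q.
Proof. by move=> Ha Hb; rewrite N.Div0.mul_mod Ha Hb -N.Div0.mul_mod. Qed.

Lemma mod_pow (q a e : N) : N.modulo (N.pow (N.modulo a q) e) q = N.modulo (N.pow a e) q.
Proof.
elim/N.peano_ind: e => // e IH; rewrite !N.pow_succ_r'.
by apply: mod_mul => //; exact: N.Div0.mod_mod.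
Qed.

Lemma mod_pow1 (q a e : N) : N.modulo a q = N.modulo 1 q -> N.modulo (N.pow a e) q = N.modulo 1 q.
Proof.
move=> Ha; elim/N.peano_ind: e => // e IH.
by rewrite N.pow_succ_r' (@mod_mul q a 1 _ 1).
Qed.

Lemma eq_residues (qs : list N) (f g : N -> N) :
  (forall q, List.In q qs -> N.modulo (f q) q = N.modulo (g q) q) ->
  residues qs f = residues qs g.
Proof. exact: map_ext_in. Qed.

Lemma mulv_residues (qs : list N) (f g : N -> N) :
  mulv qs (residues qs f) (residues qs g) = residues qs (fun q => N.mul (f q) (g q)).
Proof. by elim: qs => //= q qs ->; rewrite /mulm -N.Div0.mul_mod. Qed.

Lemma powv_residues (qs : list N) (f : N -> N) (e : N) :
  powv qs (residues qs f) e = residues qs (fun q => N.pow (f q) e).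
Proof.
by elim: qs => //= q qs ->; rewrite powmE mod_pow.
Qed.

Lemma In_pows (qs : list N) (v g : N -> N) (n s : nat) : s < n ->
  List.In (residues qs (fun q => N.mul (v q) (N.pow (g q) (N.of_nat s))))
          (pows qs (residues qs v) (residues qs g) n).
Proof.
elim: n v s => // n IH v [_|s lt_sn] /=.
  by left; apply: eq_residues => q _; rewrite N.mul_1_r.
right; rewrite mulv_residues; have := IH (fun q => N.mul (v q) (g q)) s lt_sn.
congr List.In; apply: eq_residues => q _.
by rewrite -N.mul_assoc -N.pow_succ_r' -Nat2N.inj_succ.
Qed.

Lemma In_grid (qs : list N) (b c : N -> N) (k o s t : nat) : s < k -> t < o ->
  List.In (residues qs (fun q => N.mul (N.pow (b q) (N.of_nat s)) (N.pow (c q) (N.of_nat t))))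
          (grid qs (residues qs b) (residues qs c) k o).
Proof.
move=> lt_sk lt_to; apply/in_flat_map.
exists (residues qs (fun q => N.pow (b q) (N.of_nat s))); split; last exact: In_pows.
have := @In_pows qs (fun=> 1%num) b k s lt_sk.
by congr List.In; apply: eq_residues => q _; rewrite N.mul_1_l.
Qed.

(** * Soundness of the tries *)

Fixpoint covers (qs : list N) (t : trie) (x : N) : Prop :=
  match qs, t with
  | q :: qs', Node l => exists t', List.In (N.modulo x q, t') l /\ covers qs' t' x
  | _, _ => True
  end.

Lemma target_correct (q x y z : N) : (0 < q)%num -> N.add x y = N.add z 1 ->
  N.modulo z q = target q (N.add (N.modulo x q) (N.modulo y q)).
Proof.
move=> q_gt0 e; rewrite /target.
have [ltx lty] : (N.modulo x q < q /\ N.modulo y q < q)%num by split; apply: N.mod_lt; lia.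
have := N.div_mod x q ltac:(lia); have := N.div_mod y q ltac:(lia).
move: (N.modulo x q) (N.modulo y q) (N.div x q) (N.div y q) ltx lty => u v a b ltu ltv ey ex.
symmetry; case: (N.eqb_spec (N.add u v) 0) => [uv0|uv_neq0].
  apply: (@N.mod_unique z q (N.pred (N.add a b))); first lia.
  have ab_gt0 : (0 < N.add a b)%num by nia.
  nia.
case: (N.leb_spec (N.add u v) q) => [le_uv|gt_uv].
  by apply: (@N.mod_unique z q (N.add a b)); lia.
apply: (@N.mod_unique z q (N.succ (N.add a b))); lia.
Qed.

(** The branches traced by [x], [y], [z] meet the [target] condition at every level, so the search
    follows them until [qs] is exhausted or a [Bad] is met, and there it returns false. *)
Lemma refutes_sound (qs : list N) (tx ty tz : trie) (x y z : N) :
  List.forallb (N.ltb 0) qs -> N.add x y = N.add z 1 ->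
  covers qs tx x -> covers qs ty y -> covers qs tz z -> refutes qs tx ty tz = false.
Proof.
move=> + e; elim: qs tx ty tz => //= q qs IH [//|lx] [//|ly] [//|lz] /andP[/N.ltb_lt q_gt0 qs_gt0].
move=> [tx [in_x cov_x]] [ty [in_y cov_y]] [tz [in_z cov_z]].
apply/negP => /List.forallb_forall /(_ _ in_x) /List.forallb_forall /(_ _ in_y).
move=> /List.forallb_forall /(_ _ in_z) /=.
by rewrite (@target_correct q x y z) // N.eqb_refl (IH tx ty tz).
Qed.

(* S = k S' + s, and T - j S' is replaced by T + j S' (M - 1) to stay nonnegative. *)
Lemma pow_lattice_split (q b c M K O J S T : N) : (0 < M)%num -> (0 < K)%num -> (0 < O)%num ->
  N.modulo (N.pow c M) q = N.modulo 1 q ->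
  let S' := N.div S K in
  let T2 := N.add T (N.mul (N.mul S' J) (N.pred M)) in
  N.modulo (N.mul (N.pow b S) (N.pow c T)) q =
  N.modulo (N.mul (N.mul (N.pow b (N.modulo S K)) (N.pow c (N.modulo T2 O)))
             (N.mul (N.pow (N.mul (N.pow b K) (N.pow c J)) S')
                    (N.pow (N.pow c O) (N.div T2 O)))) q.
Proof.
move=> M_gt0 K_gt0 O_gt0 cM S' T2.
have eS := N.div_mod S K ltac:(lia).
have eT := N.div_mod T2 O ltac:(lia).
(* An exact identity once [(c^M)^(S' J)], which is 1 modulo [q], is inserted. *)
have -> : N.mul (N.mul (N.pow b (N.modulo S K)) (N.pow c (N.modulo T2 O)))
             (N.mul (N.pow (N.mul (N.pow b K) (N.pow c J)) S')
                    (N.pow (N.pow c O) (N.div T2 O)))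
  = N.mul (N.pow b S) (N.mul (N.pow c T) (N.pow (N.pow c M) (N.mul S' J))).
  rewrite N.pow_mul_l -!N.pow_mul_r.
  have -> : N.pow b S = N.mul (N.pow b (N.mul K S')) (N.pow b (N.modulo S K)).
    by rewrite -N.pow_add_r -eS.
  have -> : N.mul (N.pow c T) (N.pow c (N.mul M (N.mul S' J))) =
     N.mul (N.pow c (N.mul J S')) (N.mul (N.pow c (N.mul O (N.div T2 O))) (N.pow c (N.modulo T2 O))).
    rewrite -!N.pow_add_r -eT; congr N.pow; rewrite /T2; nia.
  ring.
apply: mod_mul => //; rewrite -[in LHS](N.mul_1_r (N.pow c T)).
by apply: mod_mul => //; rewrite mod_pow1.
Qed.

Lemma levels_cons (q b0 c0 : N) (qs b c : list N) :
  levels (q :: qs) (b0 :: b) (c0 :: c) =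
  let: (o, k, j) := relation q b0 c0 in
  if is_relation q b0 c0 o k j
  then grid (q :: qs) (b0 :: b) (c0 :: c) k o
       :: levels qs (mulv qs (powv qs b (N.of_nat k)) (powv qs c (N.of_nat j)))
                    (powv qs c (N.of_nat o))
  else nil.
Proof. by []. Qed.

(** One pair of exponents [S], [T] serves all moduli at once. Reducing it by the relation at the
    first [q] gives a coset representative, which selects the child, and exponents for the new
    generators [b^k c^j] and [c^o], to which induction applies. *)
Lemma build_covers (qs : list N) (b c r : N -> N) (M x : N) : (0 < M)%num ->
  (forall q, List.In q qs -> N.modulo (N.pow (b q) M) q = N.modulo 1 q) ->
  (forall q, List.In q qs -> N.modulo (N.pow (c q) M) q = N.modulo 1 q) ->
  (exists S T, forall q, List.In q qs ->
     N.modulo x q = N.modulo (N.mul (r q) (N.mul (N.pow (b q) S) (N.pow (c q) T))) q) ->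
  covers qs (build qs (levels qs (residues qs b) (residues qs c)) (residues qs r)) x.
Proof.
move=> M_gt0; elim: qs b c r => // q qs IH b c r bM cM [S [T xE]].
set qqs := q :: qs.
rewrite levels_cons; case: relation => [[o k] j].
case: ifP => // /and4P[o_gt0 k_gt0 /N.eqb_eq + /N.eqb_eq +].
rewrite /mulm !powmE !mod_pow -N.Div0.mul_mod -/(residues qqs b) -/(residues qqs c).
set O := N.of_nat o; set K := N.of_nat k; set J := N.of_nat j.
rewrite -!/(residues qs _) !powv_residues mulv_residues => cO bKcJ.
have O_gt0 : (0 < O)%num by lia.
have K_gt0 : (0 < K)%num by lia.
pose S' := N.div S K; pose T2 := N.add T (N.mul (N.mul S' J) (N.pred M)).
pose s := N.to_nat (N.modulo S K); pose t := N.to_nat (N.modulo T2 O).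
have lt_sk : s < k by have := N.mod_lt S K ltac:(lia); lia.
have lt_to : t < o by have := N.mod_lt T2 O ltac:(lia); lia.
pose g p := N.mul (N.pow (b p) (N.of_nat s)) (N.pow (c p) (N.of_nat t)).
have split_x p : List.In p qqs -> N.modulo x p =
  N.modulo (N.mul (N.mul (r p) (g p)) (N.mul (N.pow (N.mul (N.pow (b p) K) (N.pow (c p) J)) S')
                    (N.pow (N.pow (c p) O) (N.div T2 O)))) p.
  move=> in_p; rewrite xE // -N.mul_assoc; apply: mod_mul => //.
  by rewrite (@pow_lattice_split _ _ _ M K O J) ?cM // /g !N2Nat.id.
pose w := residues qqs (fun p => N.mul (r p) (g p)).
exists (build qs (levels qs (residues qs (fun p => N.mul (N.pow (b p) K) (N.pow (c p) J)))
          (residues qs (fun p => N.pow (c p) O))) (behead w)); split.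
  apply/in_map_iff; exists w; split.
    (* Modulo [q] itself both new generators are 1. *)
    congr pair; rewrite /= split_x; last by left.
    rewrite -[LHS]N.Div0.mod_mod ?N.Div0.mod_mod -[in LHS](N.mul_1_r (N.mul _ _)).
    apply/esym/mod_mul => //; rewrite -[in RHS](N.mul_1_r 1).
    by apply: mod_mul; apply: mod_pow1.
  apply/in_map_iff; exists (residues qqs g); split; last exact: In_grid.
  by rewrite mulv_residues.
apply: IH => [p in_p|p in_p|].
- rewrite N.pow_mul_l -!N.pow_mul_r ![N.mul _ M]N.mul_comm !N.pow_mul_r -[in RHS](N.mul_1_r 1).
  by apply: mod_mul; apply: mod_pow1; [apply: bM|apply: cM]; right.
- by rewrite -N.pow_mul_r N.mul_comm N.pow_mul_r mod_pow1 // cM //; right.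
by exists S', (N.div T2 O) => p in_p; apply: split_x; right.
Qed.

Lemma tree_covers (qs : list N) (r p p' s t : N) :
  covers qs (tree qs r p p') (N.mul r (N.mul (N.pow p s) (N.pow p' t))).
Proof.
rewrite /tree; case: ifP => [/List.forallb_forall r0|_]; last by case: qs.
apply: (@build_covers _ _ _ _ period) => // [q _|q _|].
- by case: ifP => [/andP[/N.eqb_eq + _]|_]; rewrite ?powmE ?N.pow_1_l.
- by case: ifP => [/andP[_ /N.eqb_eq]|_]; rewrite ?powmE ?N.pow_1_l.
exists s, t => q /r0; case: ifP => //= _ /N.eqb_eq rq.
by rewrite N.Div0.mul_mod rq !N.mul_0_l.
Qed.

Lemma refutes_families (qs : list N) (rx px px' ry py py' rz pz pz' a1 a2 a3 a4 a5 a6 : N) :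
  List.forallb (N.ltb 0) qs ->
  refutes qs (tree qs rx px px') (tree qs ry py py') (tree qs rz pz pz') ->
  N.add (N.mul rx (N.mul (N.pow px a1) (N.pow px' a2))) (N.mul ry (N.mul (N.pow py a3) (N.pow py' a4)))
  <> N.add (N.mul rz (N.mul (N.pow pz a5) (N.pow pz' a6))) 1.
Proof.
move=> qs_gt0 + e.
by rewrite (@refutes_sound _ _ _ _ _ _ _ qs_gt0 e) //; exact: tree_covers.
Qed.

Lemma of_nat_expn (p a : nat) : N.of_nat (p ^ a) = N.pow (N.of_nat p) (N.of_nat a).
Proof. by elim: a => // a IH; rewrite expnS Nat2N.inj_mul IH Nat2N.inj_succ N.pow_succ_r'. Qed.

Lemma refutes_families_nat (qs : list N) (rx px px' ry py py' rz pz pz' a1 a2 a3 a4 a5 a6 : nat) :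
  List.forallb (N.ltb 0) qs ->
  refutes qs (tree qs (N.of_nat rx) (N.of_nat px) (N.of_nat px'))
             (tree qs (N.of_nat ry) (N.of_nat py) (N.of_nat py'))
             (tree qs (N.of_nat rz) (N.of_nat pz) (N.of_nat pz')) ->
  rx * (px ^ a1 * px' ^ a2) + ry * (py ^ a3 * py' ^ a4) <> rz * (pz ^ a5 * pz' ^ a6) + 1.
Proof.
move=> qs_gt0 ref e.
apply: (@refutes_families qs _ _ _ _ _ _ _ _ _ (N.of_nat a1) (N.of_nat a2) (N.of_nat a3)
          (N.of_nat a4) (N.of_nat a5) (N.of_nat a6) qs_gt0 ref).
by have := congr1 N.of_nat e; rewrite !Nat2N.inj_add !Nat2N.inj_mul !of_nat_expn.
Qed.

(** * Part (1): no solution with all exponents above 5 *)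

(* The complete tries are far too large: this relies on the lazy conversion of the kernel, which only expands the
   nodes that the search reaches. *)
Lemma refutes_entries_true : refutes_entries entries = true.
Proof. exact_no_check (erefl true). Qed.

Lemma refutes_entries_sound (ex ey ez : N * N * trie) (x y z : N) :
  List.In ex entries -> List.In ey entries -> List.In ez entries ->
  (ex.1.1 < ey.1.1)%num -> disjoint_pairs ex.1 ey.1 ->
  disjoint_pairs ex.1 ez.1 -> disjoint_pairs ey.1 ez.1 ->
  covers sieve ex.2 x -> covers sieve ey.2 y -> covers sieve ez.2 z ->
  N.add x y <> N.add z 1.
Proof.
move=> in_x in_y in_z /N.ltb_lt lt_xy dxy dxz dyz cov_x cov_y cov_z e.
have /List.forallb_forall/(_ _ in_x)/List.forallb_forall/(_ _ in_y) := refutes_entries_true.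
rewrite lt_xy dxy => /List.forallb_forall/(_ _ in_z); rewrite dxz dyz.
by rewrite (@refutes_sound sieve _ _ _ x y z).
Qed.

Lemma entry_covers (p p' a a' : nat) :
  List.In (N.of_nat p) odd_primes -> List.In (N.of_nat p') odd_primes -> p != p' ->
  5 < a -> 5 < a' ->
  exists e, [/\ List.In e entries,
    e.1 = (N.of_nat p, N.of_nat p') \/ e.1 = (N.of_nat p', N.of_nat p) &
    covers sieve e.2 (N.of_nat (p ^ a * p' ^ a'))].
Proof.
wlog lt_pp' : p p' a a' / p < p'.
  move=> IH in_p in_p' neq_pp' a5 a'5; case: (ltngtP p p') neq_pp' => // [lt|gt] _.
    by apply: IH => //; rewrite neq_ltn lt.
  have [|e [in_e e1 cov_e]] := IH p' p a' a gt in_p' in_p _ a'5 a5.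
    by rewrite neq_ltn gt.
  by exists e; split; rewrite 1?mulnC //; tauto.
move=> in_p in_p' _ a5 a'5.
pose u := N.of_nat p; pose v := N.of_nat p'.
have in_uv : List.In (u, v) prime_pairs.
  apply/filter_In; split; first exact: in_prod.
  by apply/N.ltb_lt; rewrite /u /v /=; lia.
(* The truncated subtractions are exact because [a] and [a'] exceed 5. *)
have cov := tree_covers sieve (N.mul (N.pow u 6) (N.pow v 6)) u v (N.of_nat (a - 6)) (N.of_nat (a' - 6)).
exists (entry (u, v)); split; [exact (in_map entry _ _ in_uv)|exact (or_introl erefl)|].
rewrite Nat2N.inj_mul !of_nat_expn -/u -/v.
have -> : N.of_nat a = N.add 6 (N.of_nat (a - 6)) by lia.
have -> : N.of_nat a' = N.add 6 (N.of_nat (a' - 6)) by lia.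
move: cov; congr (covers sieve _ _); rewrite !N.pow_add_r; ring.
Qed.

Lemma disjoint_pairs_of_neq (p p' q q' : nat) (e f : N * N) :
  p != q -> p != q' -> p' != q -> p' != q' ->
  e = (N.of_nat p, N.of_nat p') \/ e = (N.of_nat p', N.of_nat p) ->
  f = (N.of_nat q, N.of_nat q') \/ f = (N.of_nat q', N.of_nat q) ->
  disjoint_pairs e f && disjoint_pairs f e.
Proof.
by move=> n1 n2 n3 n4 [->|->] [->|->]; rewrite /disjoint_pairs /=; lia.
Qed.

Lemma In_odd_primes (p : nat) : prime p -> odd p -> p <= 19 -> List.In (N.of_nat p) odd_primes.
Proof.
have : all (fun p => prime p && odd p ==> List.existsb (N.eqb (N.of_nat p)) odd_primes) (iota 0 20) by [].
move=> /allP/(_ p) + pr_p odd_p le_p; rewrite mem_iota pr_p odd_p => /(_ le_p).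
by move=> /List.existsb_exists[q [in_q /N.eqb_eq ->]].
Qed.

Lemma no_solution_exponents_gt5 (p1 p2 p3 p4 p5 p6 a1 a2 a3 a4 a5 a6 : nat) :
  List.Forall (fun p => List.In (N.of_nat p) odd_primes) [:: p1; p2; p3; p4; p5; p6] ->
  uniq [:: p1; p2; p3; p4; p5; p6] -> all (leq 6) [:: a1; a2; a3; a4; a5; a6] ->
  p1 ^ a1 * p2 ^ a2 + p3 ^ a3 * p4 ^ a4 <> p5 ^ a5 * p6 ^ a6 + 1.
Proof.
rewrite !List.Forall_cons_iff => -[i1 [i2 [i3 [i4 [i5 [i6 _]]]]]].
rewrite /= !inE !negb_or !andbT.
case/and5P=> /and5P[n12 n13 n14 n15 n16] /and4P[n23 n24 n25 n26] /and3P[n34 n35 n36] /andP[n45 n46] n56.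
case/and5P=> g1 g2 g3 g4 /andP[g5 g6] e.
have [ex [in_x ex1 cov_x]] := entry_covers _ _ _ _ i1 i2 n12 g1 g2.
have [ey [in_y ey1 cov_y]] := entry_covers _ _ _ _ i3 i4 n34 g3 g4.
have [ez [in_z ez1 cov_z]] := entry_covers _ _ _ _ i5 i6 n56 g5 g6.
have /andP[dxy dyx] := disjoint_pairs_of_neq _ _ _ _ _ _ n13 n14 n23 n24 ex1 ey1.
have /andP[dxz _] := disjoint_pairs_of_neq _ _ _ _ _ _ n15 n16 n25 n26 ex1 ez1.
have /andP[dyz _] := disjoint_pairs_of_neq _ _ _ _ _ _ n35 n36 n45 n46 ey1 ez1.
have e' := congr1 N.of_nat e; rewrite !Nat2N.inj_add in e'.
case: (N.lt_total ex.1.1 ey.1.1) => [lt|[eq|gt]].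
- exact: (refutes_entries_sound ex ey ez _ _ _ _ _ _ lt dxy dxz dyz cov_x cov_y cov_z e').
- by move: dxy; rewrite /disjoint_pairs eq N.eqb_refl.
- rewrite N.add_comm in e'.
  exact: (refutes_entries_sound ey ex ez _ _ _ _ _ _ gt dyx dyz dxz cov_y cov_x cov_z e').
Qed.

(** If one of the distinct primes were 2, exactly one of the three terms would be even, and the two
    sides would differ in parity. *)
Lemma odd_of_equation (p1 p2 p3 p4 p5 p6 a1 a2 a3 a4 a5 a6 : nat) :
  all prime [:: p1; p2; p3; p4; p5; p6] -> uniq [:: p1; p2; p3; p4; p5; p6] ->
  all (leq 6) [:: a1; a2; a3; a4; a5; a6] ->
  p1 ^ a1 * p2 ^ a2 + p3 ^ a3 * p4 ^ a4 = p5 ^ a5 * p6 ^ a6 + 1 ->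
  all odd [:: p1; p2; p3; p4; p5; p6].
Proof.
have oddE p : prime p -> odd p = (p != 2) by move=> /even_prime[->//|]; case: eqP => // ->.
have oddXE p a : 6 <= a -> odd (p ^ a) = odd p by rewrite oddX; case: a.
rewrite /= !inE !negb_or !andbT => /and5P[r1 r2 r3 r4 /andP[r5 r6]].
move=> un /and5P[g1 g2 g3 g4 /andP[g5 g6]] /(congr1 odd).
rewrite !(oddD, oddM) !oddXE // [odd 1]/= !oddE //.
move: un; case: (p1 =P 2) => [->|_]; case: (p2 =P 2) => [->|_]; case: (p3 =P 2) => [->|_];
  case: (p4 =P 2) => [->|_]; case: (p5 =P 2) => [->|_]; case: (p6 =P 2) => [->|_];
  by rewrite /= ?eqxx ?andbF.
Qed.

(** * Part (2): the exceptional families *)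

(** Splitting off 27 makes the first term 0 modulo 3 and 27; a base 1 fills each unneeded generator
    slot. *)
Lemma pow3_ge3_no_solution (b c d e f : nat) : 3 ^ (b + 3) + 5 ^ c * 7 ^ d <> 11 ^ e * 13 ^ f + 1.
Proof.
move=> eq_n; refine (refutes_families_nat [:: 3; 8; 19; 37; 27; 73; 16; 109; 433]%num 27 3 1 1 5 7 1 11 13 b 0 c d e f isT _ _).
  exact_no_check (erefl true).
by rewrite !mul1n muln1 -[27]/(3 ^ 3) -expnD (addnC 3) eq_n.
Qed.

Lemma three_no_solution (c d e f : nat) : 3 + 5 ^ c * 7 ^ d <> 11 ^ e * 13 ^ f + 1.
Proof.
move=> eq_n; refine (refutes_families_nat [:: 3; 8; 61; 37]%num 3 1 1 1 5 7 1 11 13 0 0 c d e f isT _ _).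
  exact_no_check (erefl true).
by rewrite !mul1n eq_n.
Qed.

Lemma nine_pow5_ge2_no_solution (c d e f : nat) : 9 + 5 ^ (c + 2) * 7 ^ d <> 11 ^ e * 13 ^ f + 1.
Proof.
move=> eq_n; refine (refutes_families_nat [:: 3; 25; 37; 19; 31; 271]%num 9 1 1 25 5 7 1 11 13 0 0 c d e f isT _ _).
  exact_no_check (erefl true).
by rewrite !mul1n mulnA -[25]/(5 ^ 2) -expnD (addnC 2) eq_n.
Qed.

(** Modulo 7 the product [11^e * 13^f] is 1, which forces [f] even; it is then 1 or 4 modulo 5,
    while the equation requires 3. *)
Lemma nine_five_pow7_no_solution (d e f : nat) : 9 + 5 * 7 ^ d.+1 <> 11 ^ e * 13 ^ f + 1.
Proof.
move=> eq_n; refine (refutes_families_nat [:: 7; 25]%num 9 1 1 35 7 1 1 11 13 0 0 d 0 e f isT _ _).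
  exact_no_check (erefl true).
by rewrite !exp1n !muln1 mul1n -[35]/(5 * 7) -mulnA -expnS eq_n.
Qed.

(** Modulo 3 the left side is 1, so 3 would divide [11^e * 13^f]. *)
Lemma nine_pow7_no_solution (d e f : nat) : 9 + 7 ^ d <> 11 ^ e * 13 ^ f + 1.
Proof.
move=> eq_n; refine (refutes_families_nat [:: 3]%num 9 1 1 1 7 1 1 11 13 0 0 d 0 e f isT _ _).
  exact_no_check (erefl true).
by rewrite !exp1n !muln1 !mul1n eq_n.
Qed.

Lemma expn_mul_expn_eq1 (p q a b : nat) :
  1 < p -> 1 < q -> p ^ a * q ^ b = 1 -> a = 0 /\ b = 0.
Proof.
move=> p_gt1 q_gt1 /eqP; rewrite muln_eq1 -{1}(expn0 p) -(expn0 q).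
by rewrite !eqn_exp2l // => /andP[/eqP-> /eqP->].
Qed.

(* Equation p1^a1 p2^a2 + p3^a3 p4^a4 - p5^a5 p6^a6 = 1 over the integers,
   written additively in nat: p1^a1 p2^a2 + p3^a3 p4^a4 = p5^a5 p6^a6 + 1. *)
Theorem theorem6 :
  (forall p1 p2 p3 p4 p5 p6 a1 a2 a3 a4 a5 a6 : nat,
     prime p1 -> prime p2 -> prime p3 -> prime p4 -> prime p5 -> prime p6 ->
     uniq [:: p1; p2; p3; p4; p5; p6] ->
     p1 <= 19 -> p2 <= 19 -> p3 <= 19 -> p4 <= 19 -> p5 <= 19 -> p6 <= 19 ->
     p1 ^ a1 * p2 ^ a2 + p3 ^ a3 * p4 ^ a4 = p5 ^ a5 * p6 ^ a6 + 1 ->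
     minn a1 (minn a2 (minn a3 (minn a4 (minn a5 a6)))) <= 5)
  /\
  (forall a1 a2 a3 a4 a5 a6 : nat,
     2 ^ a1 * 3 ^ a2 + 5 ^ a3 * 7 ^ a4 = 11 ^ a5 * 13 ^ a6 + 1 <->
     [:: a1; a2; a3; a4; a5; a6] = [:: 0; 0; 0; 0; 0; 0]
     \/ [:: a1; a2; a3; a4; a5; a6] = [:: 0; 2; 1; 0; 0; 1]).
Proof.
split.
  move=> p1 p2 p3 p4 p5 p6 a1 a2 a3 a4 a5 a6 r1 r2 r3 r4 r5 r6 un l1 l2 l3 l4 l5 l6 e.
  rewrite leqNgt; apply/negP; rewrite !leq_min => gt5.
  have gt5' : all (leq 6) [:: a1; a2; a3; a4; a5; a6] by rewrite /= andbT.
  have := odd_of_equation _ _ _ _ _ _ _ _ _ _ _ _ _ un gt5' e.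
  rewrite /= r1 r2 r3 r4 r5 r6 => /(_ isT); case/and5P=> o1 o2 o3 o4 /and3P[o5 o6 _].
  apply: (no_solution_exponents_gt5 _ _ _ _ _ _ _ _ _ _ _ _ _ un gt5' e).
  by rewrite !List.Forall_cons_iff; do !split; rewrite ?List.Forall_nil //; exact: In_odd_primes.
move=> a1 a2 a3 a4 a5 a6; split; last by case=> -[-> -> -> -> -> ->].
case: a1 => [|a1] e; last first.
  by have := congr1 odd e; rewrite !(oddD, oddM, oddX) /= !orbT.
move: e; rewrite expn0 mul1n.
case: a2 => [|[|[|a2]]].
- rewrite expn0 addnC => /addIn e; left.
  (* Two equal products that are coprime are both 1. *)
  have /eqP : coprime (5 ^ a3 * 7 ^ a4) (11 ^ a5 * 13 ^ a6).
    by rewrite coprimeMl !coprimeMr !coprimeXl ?coprimeXr.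
  rewrite e gcdnn => e1; rewrite e1 in e.
  have [-> ->] := expn_mul_expn_eq1 5 7 _ _ isT isT e.
  by have [-> ->] := expn_mul_expn_eq1 11 13 _ _ isT isT e1.
- by move/three_no_solution.
- case: a3 => [|[|a3]].
  + by rewrite expn0 mul1n => /nine_pow7_no_solution.
  + case: a4 => [|a4]; last by move/nine_five_pow7_no_solution.
    (* What remains is [13 = 11^a5 * 13^a6]; [a6 = 0] would make 13 divide a power of 11, so one
       factor 13 cancels. *)
    rewrite expn0 muln1 -[_ + _]/(13 + 1) => /addIn e; right.
    case: a6 e => [|a6] e.
      have : 13 %| 11 ^ a5 by rewrite -[_ ^ _]muln1 -e.
      by rewrite Euclid_dvdX // => /andP[].
    move: e; rewrite expnS mulnCA -{1}(muln1 13) => /eqP; rewrite eqn_pmul2l // => /eqP/esym e.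
    by have [-> ->] := expn_mul_expn_eq1 11 13 _ _ isT isT e.
  + by rewrite -(addn2 a3) => /nine_pow5_ge2_no_solution.
- by rewrite -(addn3 a2) => /pow3_ge3_no_solution.
Qed.
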